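(* For a generic finite $N$-dimensional unitary system with discrete time steps, with single-step unitaries $U(k+1,k)$ ($k\ge1$) and initial unit vector $\psi\in\mathbb C^N$, the quantum vector pre-measure $\mu_{\mathsf v}:\mathfrak A\to\mathcal H$ does not extend to a vector measure on the sigma algebra $\mathfrak S_{\mathfrak A}$ generated by $\mathfrak A$. Here ''generic'' means the following. If the evolution is time independent, $U(k+1,k)=U$ for all $k$: defining $\zeta_j\ge 0$ by $\sum_{i=1}^N|U_{ij}|=1+\zeta_j$, one has $\zeta_j>0$ for all $j=1,\dots,N$. If the evolution is time dependent: defining $\zeta_j(r)\ge0$ by $\sum_{i=1}^N|U_{ij}(r,r-1)|=1+\zeta_j(r)$ and $\zeta_r=\min_j\zeta_j(r)$ for $r\ge2$, one has $\zeta_r>0$ for all $r$ and $\sum_{r\ge2}\zeta_r=\infty$.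
   Context: Finite unitary system: times $t=1,2,3,\dots$; for each $k\ge1$ an $N\times N$ unitary matrix $U(k+1,k)$ with entries $U_{ij}(k+1,k)$ in a fixed orthonormal basis $e_1,\dots,e_N$ of $\mathbb C^N$; a unit vector $\psi\in\mathbb C^N$ with $\psi(s)=\langle e_s,\psi\rangle$. $\Omega$ is the set of infinite strings $(s_1,s_2,\dots)$ with $s_i\in\{1,\dots,N\}$. For a finite string $\gamma=(s_1,\dots,s_m)$, $\mathrm{cyl}(\gamma)\subset\Omega$ is the set of infinite strings whose first $m$ entries are $s_1,\dots,s_m$. $\mathfrak A$ is the algebra generated by the cylinder sets; each of its elements is a finite disjoint union of cylinder sets of strings of one common length. The decoherence functional $D:\mathfrak A\times\mathfrak A\to\mathbb C$ is determined by finite bi-additivity and, for strings $\gamma=(s_1,\dots,s_m)$, $\gamma'=(s'_1,\dots,s'_m)$ of equal length, $$D(\mathrm{cyl}(\gamma),\mathrm{cyl}(\gamma'))=A^*(\gamma)A(\gamma')\,\delta_{s_ms'_m},\qquad A(\gamma)=U_{s_ms_{m-1}}(m,m-1)\cdots U_{s_2s_1}(2,1)\,\psi(s_1).$$ Histories Hilbert space: let $V$ be the space of finitely supported functions $u:\mathfrak A\to\mathbb C$ with $\langle u,v\rangle_V=\sum_{\alpha,\beta}u^*(\alpha)v(\beta)D(\alpha,\beta)$; $\mathcal H$ is the Hilbert space of Cauchy sequences in $V$ modulo $\{u_i\}\sim\{v_i\}$ iff $\|u_i-v_i\|_V\to0$. The quantum vector pre-measure is $\mu_{\mathsf v}(\alpha)=[\chi_\alpha]\in\mathcal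 H$, with $\chi_\alpha\in V$ equal to $1$ at $\alpha$ and $0$ elsewhere; it is finitely additive and $\langle\mu_{\mathsf v}(\alpha),\mu_{\mathsf v}(\beta)\rangle=D(\alpha,\beta)$. A vector measure on $\mathfrak S_{\mathfrak A}$ is a map $\overline{\mu_{\mathsf v}}:\mathfrak S_{\mathfrak A}\to\mathcal H$ that is countably additive in norm on every sequence of pairwise disjoint sets; it extends $\mu_{\mathsf v}$ if $\overline{\mu_{\mathsf v}}|_{\mathfrak A}=\mu_{\mathsf v}$. *)

(* Defs.v *)
From HB Require Import structures.
From mathcomp Require Import all_boot all_order all_algebra complex.
From mathcomp Require Import all_classical all_reals all_analysis.

Set Implicit Arguments.
Unset Strict Implicit.
Unset Printing Implicit Defensive.
Import Order.TTheory GRing.Theory Num.Theory.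
Import numFieldNormedType.Exports.
Local Open Scope classical_set_scope.
Local Open Scope ring_scope.

(* The times 1, 2, 3, ... are numbered from 0: [step S k] is U(k+2, k+1), and
   the entry number k of a history is s_(k+1).                                *)
Record unitary_system (R : realType) (N : nat) := UnitarySystem {
  step : nat -> 'M[R[i]]_N;
  init : 'cV[R[i]]_N;
  step_unitary : forall k, step k \is unitarymx;
  init_unit : \sum_s `|init s 0| ^+ 2 = 1
}.

Section Events.
Context {N : nat}.

Definition history := nat -> 'I_N.

(* [string m] consists of the strings of length m.+1; the empty string is
   left out.                                                                  *)
Definition string m := {ffun 'I_m.+1 -> 'I_N}.

Definition cyl m (g : string m) : set history :=
  [set w | forall k : 'I_m.+1, w k = g k].

Definition cylinders : set (set history) :=
  [set A | exists m, exists g : string m, A = cyl g].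

Definition set_algebra (G : set (set history)) :=
  [/\ G set0, setC_closed G & setU_closed G].

Definition cyl_algebra : set (set history) := smallest set_algebra cylinders.

Definition event : Type := set_type cyl_algebra.
HB.instance Definition _ := SubChoice.copy event (set_type cyl_algebra).

Definition cyl_union m : set (set history) :=
  [set A | exists G : {set string m}, A = \bigcup_(g in [set` G]) cyl g].

(* A set in [cyl_union m] only depends on the first m.+1 entries. *)
Lemma cyl_unionP m A : cyl_union m A <->
  forall v w, (forall k, (k <= m)%N -> v k = w k) -> A v -> A w.
Proof.
split=> [[G ->] v w vw [g Gg gv]|Aloc].
  by exists g => // k; rewrite -vw ?gv // -ltnS.
exists [set g : string m | `[< cyl g `<=` A >]]%SET; apply/seteqP; split => w.
  move=> Aw; exists [ffun k : 'I_m.+1 => w k]; last by move=> k; rewrite ffunE.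
  rewrite /= inE; apply/asboolP => v vg; apply: Aloc Aw => k km.
  by have := vg (Ordinal (km : k < m.+1)%N); rewrite ffunE.
by move=> [g /= + gw]; rewrite inE => /asboolP; apply.
Qed.

Lemma cyl_union_le m n A : (m <= n)%N -> cyl_union m A -> cyl_union n A.
Proof.
move=> mn /cyl_unionP HA; apply/cyl_unionP => v w vw; apply: HA => k km.
exact/vw/(leq_trans km).
Qed.

Lemma event_cyl_union A : cyl_algebra A -> exists m, cyl_union m A.
Proof.
suff : set_algebra [set A | exists m, cyl_union m A].
  move=> alg cA; apply: (cA _ (conj alg _)) => _ [m [g ->]]; exists m.
  apply/cyl_unionP => v w vw gv k; rewrite -gv; apply/esym/vw.
  by rewrite -ltnS.
split=> [|B [m /cyl_unionP mB]|B C [m mB] [n nC]] /=.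
- by exists 0%N; apply/cyl_unionP.
- exists m; apply/cyl_unionP => v w vw nBv Bw; apply: nBv.
  by apply: mB Bw => k km; rewrite vw.
- exists (maxn m n).
  move/(cyl_union_le (leq_maxl m n))/cyl_unionP in mB.
  move/(cyl_union_le (leq_maxr m n))/cyl_unionP in nC.
  by apply/cyl_unionP => v w vw [Bv|Cv]; [left; apply: mB Bv|right; apply: nC Cv].
Qed.

Lemma event_cyl_union2 (a b : event) :
  exists m, cyl_union m (val a) /\ cyl_union m (val b).
Proof.
have [[m ma] [n nb]] := (event_cyl_union (set_valP a), event_cyl_union (set_valP b)).
exists (maxn m n); split.
  exact: cyl_union_le (leq_maxl m n) ma.
exact: cyl_union_le (leq_maxr m n) nb.
Qed.

End Events.
Arguments history N : clear implicits.
Arguments string N m : clear implicits.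
Arguments event N : clear implicits.

Lemma normc_ge0 (R : rcfType) (z : R[i]) : 0 <= Normc.normc z.
Proof. by case: z => a b; exact: sqrtr_ge0. Qed.

Lemma normc_real (R : rcfType) (r : R) : Normc.normc r%:C%C = `|r|.
Proof. by rewrite /= expr0n addr0 sqrtr_sqr. Qed.

Section DecoherenceFunctional.
Context {R : realType} {N : nat} (S : unitary_system R N).
Local Notation C := R[i].

Definition amp m (g : string N m) : C :=
  (\prod_(k < m) step S k (g (lift ord0 k)) (g (widen_ord (leqnSn m) k)))
  * init S (g ord0) 0.

(* The bi-additive extension of the values prescribed on the pairs of
   cylinders of common length m.+1.                                           *)
Definition decoherence_at m (A B : set (history N)) : C :=
  \sum_(g : string N m | `[< cyl g `<=` A >])
  \sum_(h : string N m | `[< cyl h `<=` B >])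
    (amp g)^* * amp h * (g ord_max == h ord_max)%:R.

(* The number m is any one such that a and b are unions of cylinders of
   length m.+1; see [decoherenceE] for the independence of this choice, and
   [decoherence_cyl], [decoherenceDl], [decoherenceDr] for the properties
   that determine this functional.                                            *)
Definition decoherence (a b : event N) : C :=
  decoherence_at
    (xget 0%N [set m | cyl_union m (val a) /\ cyl_union m (val b)])
    (val a) (val b).

(* The sum of the amplitudes of the strings of A, sorted by final position. *)
Definition amp_row m (A : set (history N)) : 'rV[C]_N :=
  \row_s \sum_(g : string N m | `[< cyl g `<=` A >] && (g ord_max == s)) amp g.

Fixpoint back m : 'M[C]_N :=
  if m is k.+1 then map_mx Num.conj (step S k) *m back k else 1%:M.

Lemma conjmx_unitary n (A : 'M[C]_n) :
  A \is unitarymx -> map_mx Num.conj A \is unitarymx.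
Proof.
move=> /unitarymxP AA; apply/unitarymxP.
by rewrite map_trmx -map_mxM AA map_mx1.
Qed.

Lemma back_unitary m : back m \is unitarymx.
Proof.
elim: m => [|m IH] /=; first by apply/unitarymxP; rewrite trmx1 map_mx1 mulmx1.
by rewrite mul_unitarymx ?conjmx_unitary ?step_unitary.
Qed.

Lemma dotmx_unitary (A : 'M[C]_N) (x y : 'rV[C]_N) :
  A \is unitarymx -> dotmx (x *m A) (y *m A) = dotmx x y.
Proof.
move=> /unitarymxP AA; rewrite !dotmxE trmx_mul map_mxM.
by rewrite mulmxA -(mulmxA x) AA mulmx1.
Qed.

Lemma dotmx_sum (x y : 'rV[C]_N) : dotmx x y = \sum_s (y 0 s)^* * x 0 s.
Proof. by rewrite dotmxE mxE; apply: eq_bigr => s _; rewrite !mxE mulrC. Qed.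

Lemma dotmxZZ (c d : C) (x y : 'rV[C]_N) :
  dotmx (c *: x) (d *: y) = d^* * c * dotmx x y.
Proof.
rewrite !dotmx_sum mulr_sumr; apply: eq_bigr => s _.
by rewrite !mxE rmorphM mulrACA.
Qed.

Definition rvnorm (x : 'rV[C]_N) : R := Num.sqrt (complex.Re (dotmx x x)).

Lemma rvnormC x : (rvnorm x)%:C%C = sqrtC (dotmx x x).
Proof.
have x0 : 0 <= dotmx x x by apply: dnorm_ge0.
have xE := RRe_real (ger0_real x0).
rewrite -[LHS]sqrCK ?lecR ?sqrtr_ge0 // -rmorphXn /= sqr_sqrtr ?xE //.
by rewrite -lecR xE.
Qed.

Lemma rvnorm_ge0 x : 0 <= rvnorm x.
Proof. exact: sqrtr_ge0. Qed.

Lemma rvnormZ c x : rvnorm (c *: x) = Normc.normc c * rvnorm x.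
Proof.
have transfer (a b d : R) (A B : C) :
  a%:C%C = A -> d%:C%C = B -> A = b%:C%C * B -> a = b * d.
  by move=> <- <-; rewrite -rmorphM => /complexI.
apply: (transfer _ _ _ _ _ (rvnormC _) (rvnormC _)).
rewrite dotmxZZ [_ * c]mulrC -normCK.
rewrite sqrtCM ?nnegrE ?exprn_ge0 ?normr_ge0 ?dnorm_ge0 //.
by rewrite sqrCK ?normr_ge0.
Qed.

Lemma rvnormD x y : rvnorm (x + y) <= rvnorm x + rvnorm y.
Proof.
have transfer (a b d : R) (A B D : C) :
  a%:C%C = A -> b%:C%C = B -> d%:C%C = D -> A <= B + D -> a <= b + d.
  by move=> <- <- <-; rewrite -rmorphD lecR.
apply: (transfer _ _ _ _ _ _ (rvnormC _) (rvnormC _) (rvnormC _)).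
exact: (triangle_lerif (@dotmx _ N) x y).1.
Qed.

Lemma rvnorm_CS x y : Normc.normc (dotmx x y) <= rvnorm x * rvnorm y.
Proof.
have transfer (b d : R) (A B D : C) :
  b%:C%C = B -> d%:C%C = D -> `|A| <= B * D -> Normc.normc A <= b * d.
  by move=> <- <-; rewrite -rmorphM lecR.
apply: (transfer _ _ _ _ _ (rvnormC _) (rvnormC _)).
exact: (CauchySchwarz_sqrt (@dotmx _ N) x y).1.
Qed.

Definition string_rcons m (g : string N m) (s : 'I_N) : string N m.+1 :=
  [ffun k => oapp g s (unlift ord_max k)].

Definition string_belast m (g : string N m.+1) : string N m :=
  [ffun k => g (lift ord_max k)].

Lemma string_rcons_max m (g : string N m) s : string_rcons g s ord_max = s.
Proof. by rewrite ffunE unlift_none. Qed.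

Lemma string_rcons_lift m (g : string N m) s k :
  string_rcons g s (lift ord_max k) = g k.
Proof. by rewrite ffunE liftK. Qed.

Lemma big_string_rcons m (P : pred (string N m.+1)) (F : string N m.+1 -> C) :
  \sum_(g | P g) F g =
  \sum_(g : string N m) \sum_(s | P (string_rcons g s)) F (string_rcons g s).
Proof.
rewrite pair_big_dep /=.
rewrite (reindex (fun p : string N m * 'I_N => string_rcons p.1 p.2)) //=.
exists (fun g => (string_belast g, g ord_max)) => [[g s] _ | g _] /=.
  rewrite string_rcons_max; congr pair.
  by apply/ffunP => k; rewrite ffunE string_rcons_lift.
apply/ffunP => k; case: (unliftP ord_max k) => [j|] ->.
  by rewrite string_rcons_lift ffunE.
by rewrite string_rcons_max.
Qed.

Lemma amp_rcons m (g : string N m) s :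
  amp (string_rcons g s) = step S m s (g ord_max) * amp g.
Proof.
have widE (i : 'I_m.+1) : widen_ord (leqnSn m.+1) i = lift ord_max i.
  by apply: val_inj; rewrite /= /bump leqNgt ltn_ord.
rewrite /amp big_ord_recr /=.
have -> : lift ord0 (@ord_max m) = ord_max by apply: val_inj.
rewrite string_rcons_max widE string_rcons_lift.
have -> : string_rcons g s ord0 = g ord0.
  by rewrite -(string_rcons_lift g s); congr (fun_of_fin _ _); apply: val_inj.
rewrite [_ * step _ _ _ _]mulrC -mulrA; congr (_ * (_ * _)).
apply: eq_bigr => k _; rewrite widE string_rcons_lift.
have -> : lift ord0 (widen_ord (leqnSn m) k) = lift ord_max (lift ord0 k).
  by apply: val_inj; rewrite /= /bump /= add1n ltnS [(m <= k)%N]leqNgt ltn_ord.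
by rewrite string_rcons_lift.
Qed.

Lemma cyl_sub_rcons m A (g : string N m) s : cyl_union m A ->
  `[< cyl (string_rcons g s) `<=` A >] = `[< cyl g `<=` A >].
Proof.
move=> /cyl_unionP HA; apply/asbool_equiv_eq; split=> sub w; last first.
  move=> gw; apply: sub => k; rewrite -(string_rcons_lift g s) -gw /=.
  by rewrite /bump leqNgt ltn_ord.
move=> gw; pose v k := if (k <= m)%N then w k else s.
suff : A v by apply: HA => k km; rewrite /v km.
apply: sub => k; rewrite /v; case: (unliftP ord_max k) => [j|] ->.
  have -> : lift ord_max j = j :> nat by rewrite /= /bump leqNgt ltn_ord.
  by rewrite string_rcons_lift gw -ltnS ltn_ord.
by rewrite string_rcons_max /= ltnn.
Qed.

Lemma amp_rowS m A : cyl_union m A ->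
  amp_row m.+1 A = amp_row m A *m (step S m)^T.
Proof.
move=> mA; apply/rowP => s; rewrite !mxE big_string_rcons.
under eq_bigr => g _.
  under eq_bigl do rewrite cyl_sub_rcons // string_rcons_max.
  under eq_bigr do rewrite amp_rcons.
  over.
under [RHS]eq_bigr => t _ do rewrite !mxE mulr_suml.
rewrite [RHS](exchange_big_dep (fun g : string N m => `[< cyl g `<=` A >])) /=;
  last by move=> t g _ /andP[].
rewrite [RHS]big_mkcond /=; apply: eq_bigr => g _.
case: ifP => gA; last by rewrite big_pred0.
rewrite big_pred1_eq (big_pred1 (g ord_max)) 1?mulrC // => j.
by rewrite gA eq_sym.
Qed.

Lemma amp_rowE m A s : amp_row m A 0 s =
  \sum_(g : string N m | `[< cyl g `<=` A >]) amp g * (g ord_max == s)%:R.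
Proof.
rewrite mxE big_mkcondr; apply: eq_bigr => g _.
by case: eqP; rewrite ?mulr1 ?mulr0.
Qed.

Lemma decoherence_atE m A B :
  decoherence_at m A B = dotmx (amp_row m B) (amp_row m A).
Proof.
rewrite dotmx_sum.
under [RHS]eq_bigr => s _ do rewrite !amp_rowE rmorph_sum /= mulr_suml.
rewrite exchange_big /=; apply: eq_bigr => g _.
under [RHS]eq_bigr => s _ do rewrite mulr_sumr.
rewrite exchange_big /=; apply: eq_bigr => h _.
rewrite (bigD1 (h ord_max)) //= eqxx mulr1 big1 ?addr0.
  by case: eqP; rewrite ?mulr1 // !mulr0 rmorph0 mul0r.
by move=> s /negPf; rewrite eq_sym => ->; rewrite !mulr0.
Qed.

Definition vec_at m (A : set (history N)) : 'rV[C]_N := amp_row m A *m back m.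

(* [back m] undoes the evolution from time 0 to time m, so that the vectors of
   all events can be compared in one copy of C^N; see [decoherence_vec].      *)
Definition vec (A : set (history N)) : 'rV[C]_N :=
  vec_at (xget 0%N [set m | cyl_union m A]) A.

Lemma vec_at_le m n A : (m <= n)%N -> cyl_union m A -> vec_at n A = vec_at m A.
Proof.
move=> /subnK <- mA; elim: (n - m)%N => // k IH.
have kA : cyl_union (k + m) A by apply: cyl_union_le mA; exact: leq_addl.
rewrite addSn -IH /vec_at amp_rowS //= mulmxA -(mulmxA (amp_row _ _)).
suff -> : (step S (k + m))^T *m map_mx Num.conj (step S (k + m)) = 1%:M.
  by rewrite mulmx1.
have /unitarymxP/mulmx1C/(congr1 trmx) := step_unitary S (k + m).
by rewrite trmx_mul -map_trmx trmxK trmx1.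
Qed.

Lemma vec_atE m A : cyl_union m A -> vec_at m A = vec A.
Proof.
move=> mA; rewrite /vec; case: xgetP => [n _ /= nA|/(_ m)//].
have [mn|/ltnW nm] := leqP m n; first by rewrite -(vec_at_le mn).
by rewrite -(vec_at_le nm).
Qed.

Lemma decoherence_at_vec m A B : cyl_union m A -> cyl_union m B ->
  decoherence_at m A B = dotmx (vec B) (vec A).
Proof.
move=> mA mB; rewrite decoherence_atE -(vec_atE mA) -(vec_atE mB).
by rewrite dotmx_unitary ?back_unitary.
Qed.

Lemma decoherence_vec a b :
  decoherence a b = dotmx (vec (val b)) (vec (val a)).
Proof.
rewrite /decoherence; case: xgetP => [m _ [ma mb]|no].
  exact: decoherence_at_vec.
by have [m /no] := event_cyl_union2 a b.
Qed.

Lemma decoherenceE m a b : cyl_union m (val a) -> cyl_union m (val b) ->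
  decoherence a b = decoherence_at m (val a) (val b).
Proof. by move=> ma mb; rewrite decoherence_vec decoherence_at_vec. Qed.

Lemma cyl_subE m A (g : string N m) : cyl_union m A ->
  `[< cyl g `<=` A >] = ((fun k => g (inord k)) \in A).
Proof.
move=> /cyl_unionP HA; apply/asboolP/idP => [sub|].
  by rewrite inE; apply: sub => k; rewrite inord_val.
rewrite inE => Ag w gw; apply: HA Ag => k km.
by rewrite -gw inordK.
Qed.

Lemma decoherence_cyl m (g h : string N m) a b :
  val a = cyl g -> val b = cyl h ->
  decoherence a b = (amp g)^* * amp h * (g ord_max == h ord_max)%:R.
Proof.
have cylm (f : string N m) : cyl_union m (cyl f).
  apply/cyl_unionP => v w vw fv k; rewrite -fv; apply/esym/vw.
  by rewrite -ltnS.
have cyl_sub (f f' : string N m) : `[< cyl f `<=` cyl f' >] = (f == f').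
  apply/asboolP/eqP => [sub|-> //]; apply/ffunP => k.
  suff /(_ k) : cyl f' (fun k => f (inord k)) by rewrite inord_val.
  by apply: sub => j; rewrite inord_val.
move=> ag bh; rewrite (@decoherenceE m) ?ag ?bh //.
rewrite /decoherence_at (big_pred1 g) => [|f]; last by rewrite cyl_sub.
by rewrite (big_pred1 h) // => f; rewrite cyl_sub.
Qed.

Lemma vecU A B : cyl_algebra A -> cyl_algebra B -> A `&` B = set0 ->
  vec (A `|` B) = vec A + vec B.
Proof.
move=> cA cB AB.
have [m [mA mB]] := event_cyl_union2 (SigSub (mem_set cA)) (SigSub (mem_set cB)).
rewrite /= in mA mB.
have mAB : cyl_union m (A `|` B).
  move/cyl_unionP in mA; move/cyl_unionP in mB; apply/cyl_unionP => v w vw.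
  by case=> [Av|Bv]; [left; apply: mA Av|right; apply: mB Bv].
rewrite -!(@vec_atE m) // /vec_at -mulmxDl; congr (_ *m _).
apply/rowP => s; rewrite amp_rowE [RHS]mxE !amp_rowE.
rewrite big_mkcond [X in X + _]big_mkcond [X in _ + X]big_mkcond -big_split /=.
apply: eq_bigr => g _; rewrite !cyl_subE // in_setU.
case: (boolP (_ \in A)) => gA; last by case: ifP; rewrite add0r.
case: (boolP (_ \in B)) => gB; last by rewrite addr0.
by have := in_setI (fun k => g (inord k)) A B; rewrite AB in_set0 gA gB.
Qed.

Lemma decoherenceDl (a b c d : event N) :
  val a `&` val b = set0 -> val c = val a `|` val b ->
  decoherence c d = decoherence a d + decoherence b d.
Proof.
move=> ab0 cab; rewrite !decoherence_vec cab vecU ?linearDr //; exact: set_valP.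
Qed.

Lemma decoherenceDr (a b c d : event N) :
  val a `&` val b = set0 -> val c = val a `|` val b ->
  decoherence d c = decoherence d a + decoherence d b.
Proof.
move=> ab0 cab; rewrite !decoherence_vec cab vecU ?linearDl //; exact: set_valP.
Qed.

End DecoherenceFunctional.

Section FinSupp.
Context (R : realType) (N : nat).
Local Notation C := R[i].

Definition fin_supp : {pred event N -> C} :=
  [pred u | `[< finite_set [set a | u a != 0] >]].

Lemma fin_suppP u : reflect (finite_set [set a | u a != 0]) (u \in fin_supp).
Proof. exact: asboolP. Qed.

Lemma fin_supp_closed : GRing.subsemimod_closed fin_supp.
Proof.
split; first split.
- by apply/fin_suppP; apply: (@sub_finite_set _ _ set0) => // a /=; rewrite eqxx.
- move=> u v /fin_suppP fu /fin_suppP fv; apply/fin_suppP.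
  have : finite_set ([set a | u a != 0] `|` [set a | v a != 0]) by rewrite finite_setU.
  apply: sub_finite_set => a /= uv0; apply/orP; rewrite -negb_and.
  by apply: contra uv0 => /andP[/eqP u0 /eqP v0]; rewrite fctE u0 v0 addr0.
- move=> c u /fin_suppP fu; apply/fin_suppP; apply: sub_finite_set fu => a /=.
  by apply: contra => /eqP u0; rewrite fctE u0 scaler0.
Qed.

HB.instance Definition _ :=
  GRing.isSubmodClosed.Build C (event N -> C) fin_supp fin_supp_closed.

Record preH := PreH { preH_val :> event N -> C; _ : preH_val \in fin_supp }.

HB.instance Definition _ := [isSub for preH_val].
HB.instance Definition _ := [Choice of preH by <:].
HB.instance Definition _ := [SubChoice_isSubLmodule of preH by <:].

Lemma chi_subproof (a : event N) : (fun b => (b == a)%:R : C) \in fin_supp.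
Proof.
apply/fin_suppP; apply: (@sub_finite_set _ _ [set a]) => // b /=.
by case: (b =P a) => //; rewrite eqxx.
Qed.

Definition chi (a : event N) : preH := PreH (chi_subproof a).

End FinSupp.

Section HistoriesSpace.
Context {R : realType} {N : nat} (S : unitary_system R N).
Local Notation C := R[i].
Local Notation V := (preH R N).

Definition predot (u v : V) : C :=
  \sum_(a \in setT) \sum_(b \in setT) (u a)^* * v b * decoherence S a b.

Definition prenorm (u : V) : R := Num.sqrt (complex.Re (predot u u)).

Definition coords (u : V) : 'rV[C]_N := \sum_(a \in setT) u a *: vec S (val a).

Definition suppV (u : V) : seq (event N) := finmap.enum_fset (fset_set [set a | u a != 0]).

Lemma sumV_widen (M : nmodType) (F : event N -> M) (r : seq (event N)) :
  uniq r -> (forall a, a \notin r -> F a = 0) ->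
  \sum_(a \in setT) F a = \sum_(a <- r) F a.
Proof.
move=> ur F0; rewrite (fsbigE r) // => [|a _ /F0 //].
by apply: eq_bigl => a; rewrite in_setT.
Qed.

Lemma notin_suppV (u : V) a : a \notin suppV u -> u a = 0.
Proof.
move=> au; apply/eqP; apply: contraNT au => ua.
by rewrite in_fset_set ?inE //; case: u ua => u /= /fin_suppP.
Qed.

Lemma coordsE (r : seq (event N)) (u : V) :
  uniq r -> {subset suppV u <= r} ->
  coords u = \sum_(a <- r) u a *: vec S (val a).
Proof.
move=> ur ru; apply: sumV_widen => // a ar.
by rewrite notin_suppV ?scale0r //; apply: contra ar => /ru.
Qed.

Lemma coords_linear : linear coords.
Proof.
move=> c u v.
pose r := undup (suppV u ++ suppV v ++ suppV (c *: u + v)).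
have ur : uniq r by rewrite undup_uniq.
rewrite !(coordsE ur);
  try by move=> a ra; rewrite mem_undup !mem_cat ra ?orbT.
rewrite scaler_sumr -big_split /=; apply: eq_bigr => a _.
by rewrite scalerA -scalerDl.
Qed.

HB.instance Definition _ := GRing.isLinear.Build C V 'rV[C]_N _ coords coords_linear.

Lemma predotE u v : predot u v = dotmx (coords v) (coords u).
Proof.
have uu : uniq (suppV u) by exact: finmap.fset_uniq.
have uv : uniq (suppV v) by exact: finmap.fset_uniq.
rewrite (coordsE uv) // (coordsE uu) // linear_sumr /=.
rewrite /predot (sumV_widen uu); last first.
  by move=> a /notin_suppV ->; rewrite fsbig1 // => b _; rewrite rmorph0 !mul0r.
apply: eq_bigr => a _; rewrite linear_sumlz (sumV_widen uv); last first.
  by move=> b /notin_suppV ->; rewrite mulr0 mul0r.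
apply: eq_bigr => b _.
rewrite decoherence_vec; exact/esym/dotmxZZ.
Qed.

Lemma prenormE u : prenorm u = rvnorm (coords u).
Proof. by rewrite /prenorm predotE. Qed.

Lemma prenorm_ge0 u : 0 <= prenorm u.
Proof. exact: sqrtr_ge0. Qed.

Lemma prenorm0 : prenorm 0 = 0.
Proof. by rewrite prenormE linear0 -(scale0r 0) rvnormZ Normc.normc0 mul0r. Qed.

Lemma prenormZ c u : prenorm (c *: u) = Normc.normc c * prenorm u.
Proof. by rewrite !prenormE linearZ rvnormZ. Qed.

Lemma prenormD u v : prenorm (u + v) <= prenorm u + prenorm v.
Proof. by rewrite !prenormE linearD rvnormD. Qed.

Lemma prenormN u : prenorm (- u) = prenorm u.
Proof. by rewrite !prenormE linearN -scaleN1r rvnormZ normcN Normc.normc1 mul1r. Qed.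

Lemma prenormB u v : prenorm (u - v) = prenorm (v - u).
Proof. by rewrite -prenormN opprB. Qed.

Lemma prenorm_dist u v : `|prenorm u - prenorm v| <= prenorm (u - v).
Proof.
have le_dist x y : prenorm x - prenorm y <= prenorm (x - y).
  by rewrite lerBlDr -{1}(subrK y x) prenormD.
by rewrite ler_norml lerNl opprB le_dist andbT prenormB le_dist.
Qed.

Definition cauchy_pred : {pred nat -> V} :=
  [pred u | `[< forall e : R, 0 < e -> exists n0, forall m n,
                (n0 <= m)%N -> (n0 <= n)%N -> prenorm (u m - u n) < e >]].

Lemma cauchy_closed : GRing.subsemimod_closed cauchy_pred.
Proof.
split; first split.
- by apply/asboolP => e e0; exists 0%N => m n _ _; rewrite subrr prenorm0.
- move=> u v /asboolP cu /asboolP cv; apply/asboolP => e e0.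
  have e2 : 0 < e / 2 by rewrite divr_gt0.
  have [p up] := cu _ e2; have [q vq] := cv _ e2.
  exists (maxn p q) => m n; rewrite !geq_max => /andP[pm qm] /andP[pn qn].
  rewrite !fctE opprD addrACA (le_lt_trans (prenormD _ _)) //.
  by rewrite [ltRHS](splitr e); apply: ltrD; [exact: up|exact: vq].
- move=> c u /asboolP cu; apply/asboolP => e e0.
  have c0 : 0 < Normc.normc c + 1.
    by rewrite ltr_wpDl // normc_ge0.
  have [p up] := cu _ (divr_gt0 e0 c0); exists p => m n pm pn.
  rewrite !fctE -scalerBr prenormZ (le_lt_trans (y := (Normc.normc c + 1) * prenorm (u m - u n))) //.
    by rewrite ler_wpM2r ?prenorm_ge0 // lerDl.
  by rewrite mulrC -ltr_pdivlMr //; exact: up.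
Qed.

HB.instance Definition _ :=
  GRing.isSubmodClosed.Build C (nat -> V) cauchy_pred cauchy_closed.

Record cauchy_seq := CauchySeq {
  cauchy_val :> nat -> V;
  _ : cauchy_val \in cauchy_pred
}.

HB.instance Definition _ := [isSub for cauchy_val].
HB.instance Definition _ := [Choice of cauchy_seq by <:].
HB.instance Definition _ := [SubChoice_isSubLmodule of cauchy_seq by <:].

Lemma cauchy_seqP (u : cauchy_seq) (e : R) : 0 < e ->
  exists n0, forall m n, (n0 <= m)%N -> (n0 <= n)%N -> prenorm (u m - u n) < e.
Proof. by case: u => u /= /asboolP; apply. Qed.

Lemma cst_cauchy (u : V) : (fun=> u) \in cauchy_pred.
Proof. by apply/asboolP => e e0; exists 0%N => m n _ _; rewrite subrr prenorm0. Qed.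

Definition cst_seq (u : V) : cauchy_seq := CauchySeq (cst_cauchy u).

Definition null_pred : {pred cauchy_seq} :=
  [pred u : cauchy_seq | `[< (fun n => prenorm (u n)) @ \oo --> (0 : R) >]].

Lemma null_closed : GRing.subsemimod_closed null_pred.
Proof.
split; first split.
- apply/asboolP; rewrite (_ : (fun _ => _) = fun=> 0); first exact: cvg_cst.
  by apply/funext => n; rewrite prenorm0.
- move=> u v /asboolP cu /asboolP cv; apply/asboolP.
  have cuv : (fun n => prenorm (u n) + prenorm (v n)) @ \oo --> (0 : R).
    by rewrite -[0]addr0; exact: cvgD.
  apply: squeeze_cvgr (cvg_cst (0 : R)) cuv.
  by apply: nearW => n /=; rewrite prenorm_ge0 prenormD.
- move=> c u /asboolP cu; apply/asboolP.
  under eq_fun do rewrite prenormZ.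
  by rewrite -(mulr0 (Normc.normc c)); apply: cvgMr.
Qed.

HB.instance Definition _ :=
  GRing.isSubmodClosed.Build C cauchy_seq null_pred null_closed.

(* Two Cauchy sequences are identified when their difference is in
   [null_pred].                                                               *)
Definition histH : Type := Quotient.quot null_pred.

HB.instance Definition _ := GRing.Zmodule.on histH.
HB.instance Definition _ := EqQuotient.on histH.

Local Notation "[ u ]" := (\pi_histH u)%qT.

Lemma pi_histHP (u v : cauchy_seq) :
  reflect ([u] = [v]) (u - v \in null_pred).
Proof. rewrite Quotient.idealrBE; exact: eqP. Qed.

Lemma pi_histHD (u v : cauchy_seq) : [u + v] = [u] + [v].
Proof. exact: Quotient.pi_add. Qed.

Lemma pi_histH0 : [0] = 0.
Proof. by apply: (addrI [0]); rewrite -pi_histHD !addr0. Qed.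

Lemma pi_histH_repr (x : histH) : [repr x] = x.
Proof. exact: reprK. Qed.

Lemma pi_histH_surj (x : histH) : exists u, x = [u].
Proof. by exists (repr x); rewrite pi_histH_repr. Qed.

Definition scaleH (c : C) (x : histH) : histH := [c *: repr x].

Lemma pi_histHZ c (u : cauchy_seq) : [c *: u] = scaleH c [u].
Proof.
apply/pi_histHP; rewrite -scalerBr rpredZ //.
by apply/pi_histHP; rewrite pi_histH_repr.
Qed.

Lemma scaleHA a b x : scaleH a (scaleH b x) = scaleH (a * b) x.
Proof. by have [u ->] := pi_histH_surj x; rewrite -!pi_histHZ scalerA. Qed.

Lemma scaleH1 : left_id 1 scaleH.
Proof. by move=> x; have [u ->] := pi_histH_surj x; rewrite -pi_histHZ scale1r. Qed.

Lemma scaleHDr : right_distributive scaleH +%R.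
Proof.
move=> c x y; have [u ->] := pi_histH_surj x; have [v ->] := pi_histH_surj y.
by rewrite -pi_histHD -!pi_histHZ scalerDr pi_histHD.
Qed.

Lemma scaleHDl x : {morph scaleH^~ x : a b / a + b}.
Proof.
by move=> a b /=; have [u ->] := pi_histH_surj x; rewrite -!pi_histHZ scalerDl pi_histHD.
Qed.

HB.instance Definition _ :=
  GRing.Zmodule_isLmodule.Build C histH scaleHA scaleH1 scaleHDr scaleHDl.

Definition hnorm (x : histH) : R := limn (fun n => prenorm (repr x n)).

Lemma cvg_prenorm (u : cauchy_seq) : cvgn (fun n => prenorm (u n)).
Proof.
apply/cauchy_cvgP/cauchy_exP => e e0.
have [n0 un0] := cauchy_seqP u e0.
exists (prenorm (u n0)), n0 => // n /= n0n.
by rewrite /ball /= (le_lt_trans (prenorm_dist _ _)) // un0.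
Qed.

Lemma prenorm_diff0 (u v : cauchy_seq) : u - v \in null_pred ->
  (fun n => prenorm (u n) - prenorm (v n)) @ \oo --> (0 : R).
Proof.
move=> /asboolP uv0; apply: norm_cvg0.
apply: squeeze_cvgr (cvg_cst (0 : R)) uv0.
by apply: nearW => n /=; rewrite normr_ge0 prenorm_dist.
Qed.

Lemma hnorm_cvg (u : cauchy_seq) : (fun n => prenorm (u n)) @ \oo --> hnorm [u].
Proof.
have d0 : u - repr [u] \in null_pred by apply/pi_histHP; rewrite pi_histH_repr.
rewrite -[hnorm _]add0r.
have -> : (fun n => prenorm (u n)) = (fun n =>
    (prenorm (u n) - prenorm (repr [u] n)) + prenorm (repr [u] n)).
  by apply/funext => n; rewrite subrK.
by apply: cvgD (prenorm_diff0 d0) _; exact: cvg_prenorm.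
Qed.

Lemma hnormE (u : cauchy_seq) (l : R) :
  (fun n => prenorm (u n)) @ \oo --> l -> hnorm [u] = l.
Proof.
move=> /(cvg_lim (@Rhausdorff R)) <-.
by rewrite (cvg_lim (@Rhausdorff R) (@hnorm_cvg u)).
Qed.

Lemma hnormD x y : hnorm (x + y) <= hnorm x + hnorm y.
Proof.
have [u ->] := pi_histH_surj x; have [v ->] := pi_histH_surj y.
rewrite -pi_histHD.
apply: ler_cvg_to (@hnorm_cvg (u + v)) (cvgD (@hnorm_cvg u) (@hnorm_cvg v)) _.
by apply: nearW => n /=; exact: prenormD.
Qed.

Lemma hnormZ c x : hnorm (c *: x) = Normc.normc c * hnorm x.
Proof.
have [u ->] := pi_histH_surj x; rewrite -[c *: _]pi_histHZ; apply: hnormE.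
under eq_fun do rewrite prenormZ.
by apply: cvgMr; exact: hnorm_cvg.
Qed.

Lemma hnorm_eq0 x : hnorm x = 0 -> x = 0.
Proof.
have [u ->] := pi_histH_surj x; move=> u0; rewrite -[RHS]pi_histH0; apply/pi_histHP.
by rewrite subr0; apply/asboolP; rewrite -u0; exact: hnorm_cvg.
Qed.

Lemma hnormcD x y : (hnorm (x + y))%:C%C <= (hnorm x)%:C%C + (hnorm y)%:C%C :> C.
Proof. by rewrite -rmorphD lecR hnormD. Qed.

Lemma hnormcZ (c : C) x : (hnorm (c *: x))%:C%C = `|c| * (hnorm x)%:C%C :> C.
Proof. by rewrite hnormZ rmorphM. Qed.

Lemma hnormc_eq0 x : (hnorm x)%:C%C = 0 :> C -> x = 0.
Proof. by move=> /complexI/hnorm_eq0. Qed.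

HB.instance Definition _ := Lmodule_isNormed.Build C histH hnormcD hnormcZ hnormc_eq0.

Lemma norm_histH x : `|x| = (hnorm x)%:C%C.
Proof. by []. Qed.

Definition hdot (x y : histH) : C :=
  (limn (fun n => complex.Re (predot (repr x n) (repr y n))) +i*
   limn (fun n => complex.Im (predot (repr x n) (repr y n))))%C.

Lemma normc_ge_ReIm (z : C) :
  `|complex.Re z| <= Normc.normc z /\ `|complex.Im z| <= Normc.normc z.
Proof.
case: z => a b /=; rewrite -!sqrtr_sqr.
by split; apply: ler_wsqrtr; rewrite ?lerDl ?lerDr sqr_ge0.
Qed.

Lemma predot_dist u v u' v' :
  Normc.normc (predot u' v' - predot u v) <=
  prenorm (u' - u) * prenorm v' + prenorm u * prenorm (v' - v).
Proof.
have -> : predot u' v' - predot u v = predot (u' - u) v' + predot u (v' - v).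
  by rewrite !predotE !linearB linearBl linearBr addrA subrK.
apply: (le_trans (le_normcD _ _)).
rewrite !predotE !prenormE [X in _ <= X + _]mulrC [X in _ <= _ + X]mulrC.
by apply: lerD; apply: rvnorm_CS.
Qed.

Lemma hdotE (u v : cauchy_seq) (l : C) :
  (fun n => Normc.normc (predot (u n) (v n) - l)) @ \oo --> (0 : R) ->
  hdot [u] [v] = l.
Proof.
move=> uvl.
set u' := repr [u]; set v' := repr [v].
have /asboolP du : u' - u \in null_pred by apply/pi_histHP; rewrite pi_histH_repr.
have /asboolP dv : v' - v \in null_pred by apply/pi_histHP; rewrite pi_histH_repr.
have d0 : (fun n => Normc.normc (predot (u' n) (v' n) - l)) @ \oo --> (0 : R).
  have : (fun n => prenorm (u' n - u n) * prenorm (v' n) +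
      prenorm (u n) * prenorm (v' n - v n) +
      Normc.normc (predot (u n) (v n) - l)) @ \oo --> (0 : R).
    rewrite -[X in _ --> X]addr0 -{1}[0]addr0 -{1}(mul0r (hnorm [v'])).
    rewrite -{2}(mulr0 (hnorm [u])).
    apply: cvgD => //; apply: cvgD; apply: cvgM => //; exact: hnorm_cvg.
  apply: squeeze_cvgr (cvg_cst (0 : R)); apply: nearW => n /=.
  rewrite normc_ge0 /=.
  rewrite -[X in Normc.normc X](subrKA (predot (u n) (v n))).
  apply: (le_trans (le_normcD _ _)); rewrite lerD2r; exact: predot_dist.
have compE (p : C -> R) : (forall z w, p (z - w) = p z - p w) ->
    (forall z, `|p z| <= Normc.normc z) ->
    limn (fun n => p (predot (u' n) (v' n))) = p l.
  move=> pB pn; apply: (cvg_lim (@Rhausdorff R)); apply/subr_cvg0.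
  apply: norm_cvg0; apply: squeeze_cvgr (cvg_cst (0 : R)) d0.
  by apply: nearW => n /=; rewrite normr_ge0 -pB pn.
rewrite /hdot !compE; first by case: (l).
- by case=> [a b] [c d].
- by move=> z; have [] := normc_ge_ReIm z.
- by case=> [a b] [c d].
- by move=> z; have [] := normc_ge_ReIm z.
Qed.

Lemma predot_norm u : predot u u = (prenorm u ^+ 2)%:C%C.
Proof. by rewrite predotE prenormE rmorphXn /= rvnormC sqrtCK. Qed.

Lemma norm_hdot x : `|x| ^+ 2 = hdot x x.
Proof.
have [u ->] := pi_histH_surj x; rewrite norm_histH -rmorphXn /=; apply/esym/hdotE.
under eq_fun do rewrite predot_norm -rmorphB normc_real.
rewrite -(normr0 R); apply: cvg_norm; apply/subr_cvg0.
by under eq_fun do rewrite expr2; rewrite expr2; apply: cvgM; exact: hnorm_cvg.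
Qed.

Definition qvm (a : event N) : histH := [cst_seq (chi R a)].

Lemma predot_chi a b : predot (chi R a) (chi R b) = decoherence S a b.
Proof.
rewrite /predot (sumV_widen (r := [:: a])) //; last first.
  move=> c; rewrite inE => /negPf ca; rewrite fsbig1 // => d _.
  by rewrite /= ca rmorph0 !mul0r.
rewrite big_seq1 (sumV_widen (r := [:: b])) //; last first.
  by move=> c; rewrite inE => /negPf cb; rewrite /= cb mulr0 mul0r.
by rewrite big_seq1 /= !eqxx rmorph1 !mul1r.
Qed.

Lemma hdot_qvm a b : hdot (qvm a) (qvm b) = decoherence S a b.
Proof.
apply: hdotE => /=; under eq_fun do rewrite predot_chi subrr Normc.normc0.
exact: cvg_cst.
Qed.

(* The values of mu outside the sigma algebra are irrelevant. *)
Definition vector_measure (mu : set (history N) -> histH) :=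
  forall F : nat -> set (history N),
    (forall k, <<s @cyl_algebra N >> (F k)) -> trivIset setT F ->
    (fun n => \sum_(k < n) mu (F k)) @ \oo --> mu (\bigcup_k F k).

Definition extends_qvm (mu : set (history N) -> histH) :=
  forall a : event N, mu (val a) = qvm a.

End HistoriesSpace.

Section Generic.
Context {R : realType} {N : nat}.

Definition zeta (W : 'M[R[i]]_N) (j : 'I_N) : R :=
  \sum_i Normc.normc (W i j) - 1.

(* A minimum, since the index set is finite and, in presence of a unit vector,
   nonempty: see [min_zetaE].                                                 *)
Definition min_zeta (W : 'M[R[i]]_N) : R := inf (range (zeta W)).

Lemma min_zetaE W (j0 : 'I_N) :
  min_zeta W = zeta W [arg min_(j < j0) zeta W j]%O.
Proof.
case: arg_minP => // j _ jmin; apply/eqP; rewrite eq_le; apply/andP; split.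
  by apply: ge_inf; [exists (zeta W j) => _ [i _ <-]; exact: jmin|exists j].
by apply: lb_le_inf => [|_ [i _ <-]]; [exists (zeta W j), j|exact: jmin].
Qed.

Definition time_independent (S : unitary_system R N) (W : 'M[R[i]]_N) :=
  forall k, step S k = W.

Definition generic (S : unitary_system R N) :=
  (exists W, time_independent S W /\ forall j, 0 < zeta W j) \/
  [/\ ~ exists W, time_independent S W,
      forall k, 0 < min_zeta (step S k) &
      (\sum_(0 <= k <oo) (min_zeta (step S k))%:E = +oo)%E].

End Generic.

(* Main.v *)
Require Import Defs.
From mathcomp Require Import all_boot all_order all_algebra complex.
From mathcomp Require Import all_classical all_reals all_analysis.
From mathcomp Require Import lra.

Set Implicit Arguments.
Unset Strict Implicit.
Unset Printing Implicit Defensive.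
Import Order.TTheory GRing.Theory Num.Theory.
Import numFieldNormedType.Exports.
Local Open Scope classical_set_scope.
Local Open Scope ring_scope.

(** Passing from strings of length m to strings of length m+1 multiplies the
    sum of all |amplitudes| by at least 1 + zeta, so that these sums tend to infinity when the zetas have infinite sum. On the
    other hand, the vectors mu(A) live in a copy of C^N; splitting the amplitudes
    by final position and by the signs of their real and imaginary parts bounds
    each of these sums by 4 N sup |mu|. Hence mu is unbounded on the algebra. If
    mu is unbounded on the subevents of A, and B is a subevent of A with
    |mu B| > 1 + |mu A|, then |mu B| and |mu(A \ B)| are at least 1, and mu is
    unbounded on the subevents of B or of A \ B. Iterating gives disjoint events
    with |mu| >= 1, for which countable additivity fails. *)

(** * Unbounded set functions on an algebra of sets *)

Section UnboundedSetFunction.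
Context {R : realType} {N : nat} (G : set (set (history N))).
Hypothesis algG : set_algebra G.
Variable p : set (history N) -> R.
Hypothesis pU : forall A B, G A -> G B -> A `&` B = set0 ->
  p (A `|` B) <= p A + p B.
Hypothesis pUr : forall A B, G A -> G B -> A `&` B = set0 ->
  p B <= p (A `|` B) + p A.

Definition unbounded_within (A : set (history N)) :=
  forall M, exists B, [/\ G B, B `<=` A & M < p B].

Lemma set_algebraI A B : G A -> G B -> G (A `&` B).
Proof.
move: algG => [_ GC GU] GA GB.
by rewrite -(setCK (A `&` B)) setCI; apply/GC/GU; apply: GC.
Qed.

Lemma set_algebraD A B : G A -> G B -> G (A `\` B).
Proof.
move=> GA GB; rewrite setDE; apply: set_algebraI => //.
by case: algG => _ GC _; apply: GC.
Qed.

(** By [pU], bounds [M1] and [M2] on the two pieces would bound [p] by [M1 + M2] on every member of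
    [G] inside [A]. *)
Lemma unbounded_within_split A B : G B ->
  unbounded_within A ->
  unbounded_within (A `&` B) \/ unbounded_within (A `\` B).
Proof.
move=> GB uA; apply: contrapT => /not_orP[/existsNP[M1 H1] /existsNP[M2 H2]].
have [C [GC CA MC]] := uA (M1 + M2).
have le1 : p (C `&` B) <= M1.
  rewrite leNgt; apply/negP => lt1; apply: H1; exists (C `&` B).
  by split=> //; [exact: set_algebraI|exact: setSI].
have le2 : p (C `\` B) <= M2.
  rewrite leNgt; apply/negP => lt2; apply: H2; exists (C `\` B).
  by split=> //; [exact: set_algebraD|exact: setSD].
have CB0 : (C `&` B) `&` (C `\` B) = set0 by rewrite setDE setIACA setICr setI0.
have := pU (set_algebraI GC GB) (set_algebraD GC GB) CB0.
by rewrite setUIDK; lra.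
Qed.

Lemma unbounded_within_step A : G A -> unbounded_within A ->
  exists A', [/\ G A', unbounded_within A', A' `<=` A & 1 <= p (A `\` A')].
Proof.
(* This threshold gives both [1 <= p B] and [1 <= p (A \ B)], whatever the sign of [p A]; so either
   piece may be the one discarded. *)
move=> GA uA; have [B [GB BA pB]] := uA (1 + `|p A|).
have pAB : p B <= p A + p (A `\` B).
  have := pUr (set_algebraD GA GB) GB (setDKI _ _).
  by rewrite setDKU.
have pA := ler_norm (p A).
case: (unbounded_within_split GB uA) => uB.
  exists (A `&` B); split=> //; first exact: set_algebraI.
  by rewrite setDIr setDv set0U; lra.
exists (A `\` B); split=> //; first exact: set_algebraD.
have -> : A `\` (A `\` B) = B by rewrite setDD; apply/setIidPr.
have := normr_ge0 (p A); lra.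
Qed.

(** Dependent choice iterates the previous lemma into a decreasing sequence [E]; its successive
    differences are the required sets. *)
Lemma unbounded_disjoint_sequence : unbounded_within setT ->
  exists F : nat -> set (history N),
    [/\ forall k, G (F k), trivIset setT F & forall k, 1 <= p (F k)].
Proof.
move=> uT; pose Q := {A | G A /\ unbounded_within A}.
have GT : G setT by rewrite -setC0; move: algG => [G0 GC _]; exact: GC.
have step_ex (A : Q) :
    {A' : Q | sval A' `<=` sval A /\ 1 <= p (sval A `\` sval A')}.
  apply: cid; case: A => A [GA uA].
  have [A' [GA' uA' sub pA']] := unbounded_within_step GA uA.
  by exists (exist _ A' (conj GA' uA')).
pose E k : Q := iter k (fun A => sval (step_ex A)) (exist _ setT (conj GT uT)).
have ES k := svalP (step_ex (E k)).
have Edec j k : (j <= k)%N -> sval (E k) `<=` sval (E j).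
  move=> /subnK <-; elim: (k - j)%N => [//|n]; apply: subset_trans.
  exact: (ES (n + j)%N).1.
exists (fun k => sval (E k) `\` sval (E k.+1)); split.
- by move=> k; apply: set_algebraD;
    [exact: (svalP (E k)).1|exact: (svalP (E k.+1)).1].
- apply: ltn_trivIset => k j jk; apply/seteqP; split=> // w [[_ nEj] [Ek _]].
  by apply: nEj; exact: Edec Ek.
- by move=> k; exact: (ES k).2.
Qed.

End UnboundedSetFunction.

(** * Unions of cylinders of one length *)

Section CylinderAlgebra.
Context {N : nat}.

Lemma cyl_algebra_alg : set_algebra (@cyl_algebra N).
Proof.
split=> [G [[G0 _ _] _]|A cA G GG|A B cA cB G GG]; first exact: G0.
  by have [[_ GC _] _] := GG; apply: GC; exact: cA GG.
by have [[_ _ GU] _] := GG; apply: GU; [exact: cA GG|exact: cB GG].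
Qed.

Lemma cyl_union_event m (A : set (history N)) : cyl_union m A -> cyl_algebra A.
Proof.
case=> P ->; have [c0 _ cU] := cyl_algebra_alg.
rewrite bigcup_pred; apply: big_ind => // g _.
by apply: sub_gen_smallest; exists m, g.
Qed.

Lemma cyl_sub_bigcup m (P : {set string N m}) (g : string N m) :
  `[< cyl g `<=` \bigcup_(h in [set` P]) cyl h >] = (g \in P).
Proof.
apply/asboolP/idP => [sub|gP w gw]; last by exists g.
(* A point of [cyl g]: past position [m], [inord] repeats the first entry of [g]. *)
have [h hP hg] : (\bigcup_(h in [set` P]) cyl h) (fun k => g (inord k)).
  by apply: sub => k; rewrite inord_val.
suff -> : g = h by [].
by apply/ffunP => k; rewrite -hg inord_val.
Qed.

End CylinderAlgebra.

(** * Growth of the total amplitude against bounds on the vectors *)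

Section Growth.
Context {R : realType} {N : nat} (S : unitary_system R N).
Local Notation C := R[i].
Local Notation nc := Normc.normc.

(** Cauchy-Schwarz against a basis vector. *)
Lemma rvnorm_row (x : 'rV[C]_N) s : nc (x 0 s) <= rvnorm x.
Proof.
have dE y : dotmx y (delta_mx 0 s : 'rV[C]_N) = y 0 s.
  rewrite dotmx_sum (bigD1 s) //= big1 ?addr0 => [|t ts].
    by rewrite mxE !eqxx rmorph1 mul1r.
  by rewrite mxE (negPf ts) andbF rmorph0 mul0r.
have := rvnorm_CS x (delta_mx 0 s).
by rewrite dE {2}/rvnorm dE mxE !eqxx /= sqrtr1 mulr1.
Qed.

Lemma rvnormN (x : 'rV[C]_N) : rvnorm (- x) = rvnorm x.
Proof. by rewrite -scaleN1r rvnormZ normcN Normc.normc1 mul1r. Qed.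

Lemma rvnorm_vec m A : cyl_union m A ->
  rvnorm (vec S A) = rvnorm (amp_row S m A).
Proof.
by move=> mA; rewrite -(vec_atE S mA) /rvnorm dotmx_unitary ?back_unitary.
Qed.

Definition amp_total m : R := \sum_(g : string N m) nc (amp S g).

Lemma sum_string_rcons m (F : string N m.+1 -> R) :
  \sum_g F g = \sum_(g : string N m) \sum_s F (string_rcons g s).
Proof.
(* The complex version is transferred to real sums through the embedding of [R]. *)
have := big_string_rcons xpredT (fun g => (F g)%:C%C).
rewrite -rmorph_sum /= => /(congr1 (@complex.Re R)) /= ->.
by under eq_bigr do rewrite -rmorph_sum; rewrite -rmorph_sum.
Qed.

Lemma amp_total0_gt0 : 0 < amp_total 0.
Proof.
rewrite lt_def sumr_ge0 ?andbT => [|g _]; last exact: normc_ge0.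
apply/eqP => /psumr_eq0P a0.
have : \sum_s `|init S s 0| ^+ 2 = 0.
  rewrite big1 // => s _.
  have := a0 (fun g _ => normc_ge0 _) [ffun => s] isT.
  rewrite /amp big_ord0 mul1r ffunE => /Normc.eq0_normc ->.
  by rewrite normr0 expr0n.
by rewrite init_unit => /eqP; rewrite oner_eq0.
Qed.

Lemma min_zeta_le m j : min_zeta (step S m) <= zeta (step S m) j.
Proof. by rewrite (min_zetaE _ j); case: arg_minP => // i _; apply. Qed.

(** The extensions of [g] multiply its modulus by the entries of the column indexed by its last
    position, whose moduli sum to 1 + zeta. *)
Lemma amp_totalS m : (1 + min_zeta (step S m)) * amp_total m <= amp_total m.+1.
Proof.
rewrite /amp_total sum_string_rcons mulr_sumr; apply: ler_sum => g _.
under eq_bigr do rewrite amp_rcons Normc.normcM.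
rewrite -mulr_suml ler_wpM2r ?normc_ge0 //.
by have := min_zeta_le m (g ord_max); rewrite /zeta; lra.
Qed.

(** Each step adds at least zeta times [amp_total 0], since the totals never fall below their
    initial value. *)
Lemma amp_total_ge m : (forall k, 0 <= min_zeta (step S k)) ->
  amp_total 0 * (1 + \sum_(k < m) min_zeta (step S k)) <= amp_total m.
Proof.
move=> z0; elim: m => [|m IH]; first by rewrite big_ord0 addr0 mulr1.
have L0 := amp_total0_gt0.
have L0m : amp_total 0 <= amp_total m.
  apply: le_trans IH; rewrite ler_peMr ?(ltW L0) // lerDl; exact: sumr_ge0.
have := ler_wpM2l (z0 m) L0m.
have := amp_totalS m.
rewrite big_ord_recr /= !mulrDl !mulrDr !mulr1 !mul1r in IH *.
lra.
Qed.

(** Meant for [f] the real or imaginary part: within one sign class of [f] nothing cancels, so each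
    of the [N] final positions costs [K] per sign. *)
Lemma sum_part_amp_le m (f : C -> R) (K : R) :
  f 0 = 0 -> {morph f : z w / z + w} -> (forall z, `|f z| <= nc z) ->
  (forall A, cyl_union m A -> rvnorm (vec S A) <= K) ->
  \sum_(g : string N m) `|f (amp S g)| <= (K + K) *+ N.
Proof.
move=> f0 fD fn HK.
(* One event serves all [s]: entry [s] of its [amp_row] keeps just the strings ending at [s]. *)
have row_le (P : {set string N m}) s :
    `|\sum_(g in P | g ord_max == s) f (amp S g)| <= K.
  set A := \bigcup_(h in [set` P]) cyl h.
  have mA : cyl_union m A by exists P.
  have -> : \sum_(g in P | g ord_max == s) f (amp S g) = f (amp_row S m A 0 s).
    rewrite mxE (big_morph f fD f0); apply: eq_bigl => g.
    by rewrite cyl_sub_bigcup.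
  apply: le_trans (fn _) (le_trans (rvnorm_row _ _) _).
  by rewrite -rvnorm_vec // HK.
rewrite (partition_big (fun g : string N m => g ord_max) xpredT) //=.
rewrite -[X in _ *+ X]card_ord -sumr_const; apply: ler_sum => s _.
rewrite (bigID (fun g => 0 <= f (amp S g))) /=; apply: lerD.
  apply: le_trans (row_le [set g | 0 <= f (amp S g)]%SET s).
  apply: le_trans (ler_norm _); rewrite le_eqVlt; apply/orP; left; apply/eqP.
  apply: eq_big => [g|g /andP[_ ?]]; first by rewrite inE andbC.
  by rewrite ger0_norm.
apply: le_trans (row_le [set g | ~~ (0 <= f (amp S g))]%SET s).
rewrite -normrN; apply: le_trans (ler_norm _).
rewrite le_eqVlt; apply/orP; left; apply/eqP; rewrite -sumrN.
apply: eq_big => [g|g /andP[_]]; first by rewrite inE andbC.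
by rewrite -ltNge => /ltr0_norm.
Qed.

Lemma amp_total_le m (K : R) :
  (forall A, cyl_union m A -> rvnorm (vec S A) <= K) ->
  amp_total m <= (K + K) *+ N + (K + K) *+ N.
Proof.
move=> HK; apply: (@le_trans _ _ (\sum_(g : string N m)
    (`|complex.Re (amp S g)| + `|complex.Im (amp S g)|))).
  apply: ler_sum => g _; case: (amp S g) => a b /=.
  rewrite -(ler_pXn2r (n := 2)) ?nnegrE ?addr_ge0 ?sqrtr_ge0 //.
  rewrite sqr_sqrtr ?addr_ge0 ?sqr_ge0 // sqrrD !real_normK ?num_real //.
  by rewrite addrAC lerDl mulrn_wge0 // mulr_ge0.
rewrite big_split /=; apply: lerD; apply: sum_part_amp_le => //.
- by case=> [a b] [c d].
- by move=> z; have [] := normc_ge_ReIm z.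
- by case=> [a b] [c d].
- by move=> z; have [] := normc_ge_ReIm z.
Qed.

(** In dimension 0 there is no unit vector; an index is needed for the infimum [min_zeta] to be
    attained. *)
Lemma system_index : inhabited 'I_N.
Proof.
have [j _|N0] := pickP (@predT 'I_N); first exact: inhabits.
have := init_unit S; rewrite big_pred0 // => /esym/eqP.
by rewrite oner_eq0.
Qed.

Lemma generic_min_zeta_gt0 k : generic S -> 0 < min_zeta (step S k).
Proof.
move=> [[W [SW Wpos]]|[_ zpos _]] //.
by have [j] := system_index; rewrite SW (min_zetaE _ j).
Qed.

Lemma generic_min_zeta_unbounded (B : R) : generic S ->
  exists m, B < \sum_(k < m) min_zeta (step S k).
Proof.
move=> gS; have z0 k := generic_min_zeta_gt0 k gS.
case: gS => [[W [SW _]]|[_ _ zoo]].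
  have W0 : 0 < min_zeta W by rewrite -(SW 0%N).
  (* The terms are constant and positive, so any [m] above this quotient works. *)
  exists (Num.truncn (B / min_zeta W)).+1.
  under eq_bigr do rewrite SW.
  by rewrite sumr_const card_ord -mulr_natl -ltr_pdivrMr // truncnS_gt.
apply: contrapT => /forallNP leB.
suff : (\sum_(0 <= k <oo) (min_zeta (step S k))%:E <= B%:E)%E by rewrite zoo.
apply: lime_le; first by apply: is_cvg_nneseries => k _ _; rewrite lee_fin ltW.
apply: nearW => m; rewrite sumEFin lee_fin big_mkord leNgt; exact/negP.
Qed.

Lemma generic_vec_unbounded : generic S ->
  unbounded_within cyl_algebra (fun A => rvnorm (vec S A)) setT.
Proof.
move=> gS K; apply: contrapT => /forallNP HK.
(* Chosen so that a sum of zetas above [c] makes the lower bound of [amp_total_ge] exceed the upper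
   bound of [amp_total_le]. *)
pose c := ((K + K) *+ N + (K + K) *+ N) / amp_total 0.
have [m] := generic_min_zeta_unbounded c gS.
rewrite /c ltr_pdivrMr ?amp_total0_gt0 // => cm.
have mK : amp_total m <= (K + K) *+ N + (K + K) *+ N.
  apply: amp_total_le => A /cyl_union_event cA; rewrite leNgt; apply/negP => KA.
  by apply: (HK A).
have := amp_total_ge m (fun k => ltW (generic_min_zeta_gt0 k gS)).
have := amp_total0_gt0; rewrite mulrDr mulr1 [_ * \sum_(_ < _) _]mulrC.
lra.
Qed.

Lemma norm_qvm (a : event N) : `|qvm S a| = (rvnorm (vec S (val a)))%:C%C.
Proof.
rewrite norm_histH; congr (_%:C%C); apply: hnormE => /=.
suff -> : prenorm S (chi R a) = rvnorm (vec S (val a)) by exact: cvg_cst.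
by rewrite /prenorm predot_chi decoherence_vec.
Qed.

End Growth.

(** * Failure of countable additivity *)

Theorem mainTheorem5 (R : realType) (N : nat) (S : unitary_system R N) :
  generic S ->
  ~ exists mu : set (history N) -> histH S,
      vector_measure mu /\ extends_qvm mu.
Proof.
move=> gS [mu [mu_meas mu_ext]].
have vecD A B : cyl_algebra A -> cyl_algebra B -> A `&` B = set0 ->
    rvnorm (vec S (A `|` B)) <= rvnorm (vec S A) + rvnorm (vec S B).
  by move=> cA cB AB; rewrite vecU // rvnormD.
have vecDr A B : cyl_algebra A -> cyl_algebra B -> A `&` B = set0 ->
    rvnorm (vec S B) <= rvnorm (vec S (A `|` B)) + rvnorm (vec S A).
  move=> cA cB AB; rewrite vecU // -(rvnormN (vec S A)).
  by apply: le_trans (rvnormD _ _); rewrite addrAC subrr add0r.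
have [F [cF tF F1]] := unbounded_disjoint_sequence (@cyl_algebra_alg N)
  vecD vecDr (generic_vec_unbounded gS).
have mu_cvg := mu_meas F (fun k => sub_gen_smallest (cF k)) tF.
(* The terms of a norm-convergent series tend to 0, against [F1]. *)
have mu0 : (fun n => mu (F n)) @ \oo --> (0 : histH S).
  apply: cvg_series_cvg_0; apply/cvg_ex; exists (mu (\bigcup_k F k)).
  suff -> : series (fun n => mu (F n)) = fun n => \sum_(k < n) mu (F k) by [].
  by apply/funext => n; rewrite /series /= big_mkord.
have /(_ _ 1 ltr01)[n _ /(_ n (leqnn n))] /= := (cvgr0Pnorm_lt _).1 mu0.
rewrite (mu_ext (SigSub (mem_set (cF n)))) norm_qvm /=.
rewrite -(rmorph1 (real_complex R)) ltcR ltNge => /negP; apply; exact: F1.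
Qed.
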